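(* $\operatorname{non}^*_\omega(\mathrm{nwd})=\operatorname{non}(\mathcal M)$.
   Context: $\mathrm{nwd}$ is the ideal of nowhere dense subsets of $2^{<\omega}$: $A\subseteq2^{<\omega}$ is nowhere dense iff every $s\in2^{<\omega}$ has an extension $t\supseteq s$ in $2^{<\omega}$ such that no extension of $t$ belongs to $A$. For an ideal $\mathscr I$ on a countable set $X$, $\operatorname{non}^*_\omega(\mathscr I)=\min\{|\mathcal A|:\mathcal A\subseteq[X]^\omega,\ \forall\overline B\in[\mathscr I]^\omega\,\exists A\in\mathcal A\,\forall B\in\overline B\ |A\cap B|<\omega\}$, where $[Y]^\omega$ is the set of countably infinite subsets of $Y$. $\operatorname{non}(\mathcal M)$ is the least size of a nonmeager subset of $2^\omega$. *)

(* Defs.v *)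
From mathcomp Require Import all_boot.
From mathcomp Require Import boolp classical_sets functions cardinality.
From mathcomp Require Import topology cantor.

Set Implicit Arguments.
Unset Strict Implicit.
Unset Printing Implicit Defensive.

Local Open Scope classical_set_scope.
Local Open Scope card_scope.

(* A cardinal given as a minimum is represented by a set that realizes it:
   [least_card P A] says that |A| = min {|B| : P B}, the minimum being attained
   at A.  Such an A is unique up to equipotence. *)
Definition least_card (T : Type) (P : set (set T)) (A : set T) : Prop :=
  P A /\ forall B : set T, P B -> A #<= B.

(* [Y]^omega *)
Definition countably_infinite_subsets (T : Type) (Y : set T) : set (set T) :=
  [set A | A `<=` Y /\ A #= [set: nat]].

(* The families over which non*_omega(I) is a minimum, for an ideal I on X. *)
Definition non_star_omega_family (X : Type) (I : set (set X))
    : set (set (set X)) :=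
  [set F | F `<=` countably_infinite_subsets [set: X] /\
     forall Bs : set (set X), countably_infinite_subsets I Bs ->
       exists2 A, F A & forall B, Bs B -> finite_set (A `&` B)].

(* 2^{<omega} is [seq bool], ordered by end-extension [prefix s t]. *)
Definition nwd : set (set (seq bool)) :=
  [set A | forall s : seq bool, exists2 t : seq bool, prefix s t &
     forall u : seq bool, prefix t u -> ~ A u].

Definition nowhere_dense (T : topologicalType) (A : set T) : Prop :=
  interior (closure A) = set0.

Definition meager (T : topologicalType) (M : set T) : Prop :=
  exists2 F : nat -> set T,
    (forall n, nowhere_dense (F n)) & M = \bigcup_n F n.

(* Main.v *)
(* [<=]: send a branch [x] to the infinite set [A_x] of its initial segments; if
   [B] is nwd then [{x | A_x meets B infinitely often}] is nowhere dense, so a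
   nonmeager set of branches yields a family for non*_omega(nwd).

   [>=]: an infinite [A] has a limit point [p] and, passing to a subset
   [{a_0, a_1, ...}] converging fast to [p], a concatenation
   [x = a_0 ++ a_1 ++ ...] in which [a_k] agrees with [p] up to the length of
   [a_0 ++ ... ++ a_(k-1)].  For nwd [T] and [U], the set [C] of all [s] such
   that [w ++ s] is in [U] for some [w] with [s] restricted to [size w] in [T]
   is nwd: above a node with no extension in [T] only finitely many [w] matter.
   If [p] is a branch of [T] and [x] a branch of [U], then all [a_k] are in [C].
   Hence the points [p] and the points [x] arising from the members [A] of a
   family for non*_omega(nwd) cannot both form a meager set. *)

Require Import Defs.
From mathcomp Require Import all_boot.
From mathcomp Require Import boolp classical_sets functions cardinality.
From mathcomp Require Import topology cantor.

Set Implicit Arguments.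
Unset Strict Implicit.
Unset Printing Implicit Defensive.

Local Open Scope classical_set_scope.
Local Open Scope card_scope.

(** * Least cardinals *)

(* Zorn's lemma: take a maximal set [D] of choice functions any two of which
   differ at every index; some evaluation maps [D] onto [B i], and every
   evaluation is injective on [D]. *)
Lemma exists_least_card (I T : Type) (B : I -> set T) :
  I -> exists i, forall j, B i #<= B j.
Proof.
move=> i0.
pose separated (D : set (I -> T)) :=
  (forall f, D f -> forall i, B i (f i)) /\
  (forall f g, D f -> D g -> forall i, f i = g i -> f = g).
have [|D [[DB Dinj] Dmax]] := @Zorn_bigcup _ separated.
  move=> F Fsep Ftot; split=> [f [X FX Xf]|f g [X FX Xf] [Y FY Yg]].
    exact: (Fsep _ FX).1.
  have [XY|YX] := Ftot _ _ FX FY.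
    by apply: (Fsep _ FY).2 => //; apply: XY.
  by apply: (Fsep _ FX).2 => //; apply: YX.
have [i Bi] : exists i, B i `<=` (fun f => f i) @` D.
  apply: contrapT => /forallNP noti.
  have /choice[f fP] : forall i, exists b, B i b /\ forall g, D g -> g i <> b.
    move=> i; have /nonsubset[b [Bb Db]] := noti i.
    by exists b; split=> // g Dg gb; apply: Db; exists g.
  apply: (Dmax (f |` D)).
    split; first by move=> g Dg; right.
    by move=> /(_ f (or_introl erefl)) Df; have [_ /(_ f Df)] := fP i0.
  split=> [g [->|Dg] i|g h].
  - by case: (fP i).
  - exact: DB.
  - move=> [->|Dg] [->|Dh] i //.
    + by move=> fh; case: (fP i) => _ /(_ h Dh) /(_ (esym fh)).
    + by move=> gf; case: (fP i) => _ /(_ g Dg) /(_ gf).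
    + exact: Dinj.
exists i => j; apply: card_le_trans (subset_card_le Bi) _.
apply: card_le_trans (card_image_le _ _) _.
have /card_esym/card_eqPle[Dj _] : (fun f : I -> T => f j) @` D #= D.
  by apply: inj_card_eq => f g /set_mem Df /set_mem Dg /Dinj; apply.
by apply: card_le_trans Dj (subset_card_le _) => _ [f Df <-]; apply: DB.
Qed.

(** * Nowhere dense subsets of the binary tree *)

Lemma finite_size_le (N : nat) : finite_set [set s : seq bool | size s <= N].
Proof.
elim: N => [|N IH].
  by apply: (@sub_finite_set _ _ [set [::]]) => [[|//]|] //.
apply: (@sub_finite_set _ _ ([set [::]] `|`
    (cons true @` [set s : seq bool | size s <= N] `|`
     cons false @` [set s : seq bool | size s <= N]))).
  move=> [|[] s] /=; [by left|right; left|right; right]; by exists s.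
rewrite !finite_setU; split; first exact: finite_set1.
by split; apply: finite_image.
Qed.

Lemma infinite_seq_boolP (A : set (seq bool)) :
  infinite_set A <-> forall N, exists2 s, A s & N < size s.
Proof.
split=> [infA N|unbA finA].
  apply: contrapT => noA; apply: infA.
  apply: sub_finite_set (finite_size_le N) => s As /=.
  by rewrite leqNgt; apply/negP => Ns; apply: noA; exists s.
have /finite_seqP[r rA] := finA.
have [s As] := unbA (\max_(t <- r) size t).
rewrite ltnNge; apply/negP/negPn.
by apply: leq_bigmax_seq => //; move: As; rewrite rA.
Qed.

Lemma nwd_subset {A B : set (seq bool)} : A `<=` B -> nwd B -> nwd A.
Proof.
by move=> AB nB s; have [t st tB] := nB s; exists t => // u tu /AB; apply: tB.
Qed.

Lemma nwdU (A B : set (seq bool)) : nwd A -> nwd B -> nwd (A `|` B).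
Proof.
move=> nA nB s; have [t st tA] := nA s; have [u tu uB] := nB t.
exists u => [|v uv []]; first exact: prefix_trans st tu.
  exact/tA/(prefix_trans tu).
exact: uB.
Qed.

Lemma nwd_quotient (w : seq bool) (A : set (seq bool)) :
  nwd A -> nwd [set s | A (w ++ s)].
Proof.
move=> nA s; have [t /prefixP[u ->] tA] := nA (w ++ s).
exists (s ++ u); first exact: prefix_prefix.
by move=> _ /prefixP[v ->] /=; rewrite !catA; apply: tA; apply: prefix_prefix.
Qed.

(** Induction on [N]: peeling the first letter off [w] lowers the bound and leaves a union of three
    nwd sets. *)
Lemma nwd_quotients (N : nat) (A : set (seq bool)) :
  nwd A -> nwd [set s | exists2 w, size w <= N & A (w ++ s)].
Proof.
elim: N A => [|N IH] A nA.
  by apply: nwd_subset nA => s [[|//]].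
have nq b := IH _ (nwd_quotient [:: b] nA).
apply: nwd_subset (nwdU nA (nwdU (nq true) (nq false))) => s [[|[] w] wN Aw].
- by left.
- by right; left; exists w.
- by right; right; exists w.
Qed.

Lemma finite_set_nwd (A : set (seq bool)) : finite_set A -> nwd A.
Proof.
move=> finA s; have [N AN] : exists N, forall t, A t -> size t <= N.
  apply: contrapT => /forallNP unbA; apply/infinite_seq_boolP: finA => N.
  by have /existsNP[t /not_implyP[At /negP]] := unbA N; rewrite -ltnNge; exists t.
exists (s ++ nseq N.+1 true); first exact: prefix_prefix.
move=> u /size_prefix; rewrite size_cat size_nseq => su /AN uN.
by have := leq_trans su uN; rewrite addnS ltnNge leq_addl.
Qed.

Lemma nwd_compare (A B : set (seq bool)) : nwd A -> nwd B ->
  nwd [set s | exists w, [/\ size w <= size s, A (take (size w) s) & B (w ++ s)]].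
Proof.
move=> nA nB s; have [t st tA] := nA s.
have [u tu uB] := nwd_quotients (size t) nB t.
exists u => [|v uv [w [wv Aw Bw]]]; first exact: prefix_trans st tu.
(* If [w] were longer than [t], then [take (size w) v] would extend [t] and so miss [A]. *)
apply: (uB v uv); exists w => //; rewrite leqNgt; apply/negP => tw.
apply: (tA _ _ Aw); have /prefixP[r ->] := prefix_trans tu uv.
by rewrite take_cat ltnNge (ltnW tw) /= prefix_prefix.
Qed.

(** * Branches as limits of chains *)

Lemma mkseq_prefix {T : eqType} (x : nat -> T) {m n} :
  m <= n -> prefix (mkseq x m) (mkseq x n).
Proof.
by move=> mn; rewrite /mkseq -(subnKC mn) iotaD map_cat prefix_prefix.
Qed.

Lemma prefix_mkseq {T : eqType} {x : nat -> T} {n} {s : seq T} :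
  prefix s (mkseq x n) -> s = mkseq x (size s).
Proof.
move=> sx; have := size_prefix sx; rewrite size_mkseq => sn.
have := sx; rewrite prefixE => /eqP <-.
by rewrite size_takel ?size_mkseq// /mkseq -map_take take_iota (minn_idPl sn).
Qed.

(** Dependent choice along the tree, shared by the limit point, the concatenation and the Baire
    argument: [P] is the invariant, [R k] the demand met at step [k]. *)
Lemma prefix_chain_limit (P : set (seq bool))
    (R : nat -> seq bool -> seq bool -> Prop) :
  P [::] ->
  (forall k s, P s ->
     exists t, [/\ P t, prefix s t, size s < size t & R k s t]) ->
  exists x : nat -> bool, forall k, exists n m,
    [/\ k <= n, P (mkseq x n) & R k (mkseq x n) (mkseq x m)].
Proof.
move=> P0 Pstep.
have /choice[f fP] : forall ks : nat * seq bool, exists t, P ks.2 ->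
    [/\ P t, prefix ks.2 t, size ks.2 < size t & R ks.1 ks.2 t].
  move=> [k s]; have [/(Pstep k)[t tP]|nPs] := pselect (P s); first by exists t.
  by exists [::].
pose w := fix w k := if k is k'.+1 then f (k', w k') else [::].
have Pw k : P (w k) by elim: k => //= k IH; have [] := fP (k, w k) IH.
have wS k : [/\ prefix (w k) (w k.+1), size (w k) < size (w k.+1)
    & R k (w k) (w k.+1)].
  by have [] := fP (k, w k) (Pw k).
have wD k l : prefix (w k) (w (k + l)).
  elim: l => [|l IH]; first by rewrite addn0 prefix_refl.
  by rewrite addnS; apply: prefix_trans IH _; have [] := wS (k + l).
have w_size k : k <= size (w k).
  by elim: k => // k IH; apply: leq_ltn_trans IH _; have [] := wS k.
(* [w i.+1] has length at least [i.+1], so the default [false] is never read. *)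
pose x i := nth false (w i.+1) i.
have wx k : w k = mkseq x (size (w k)).
  apply: (@eq_from_nth _ false) => [|i ik]; rewrite ?size_mkseq// nth_mkseq//.
  have nthw m n : i < size (w m) -> m <= n ->
      nth false (w m) i = nth false (w n) i.
    move=> im mn; have /prefixP[r] := wD m (n - m); rewrite subnKC// => ->.
    by rewrite nth_cat im.
  have [ki|ki] := leqP k i.+1; first exact: nthw.
  by rewrite -(nthw i.+1 k)// ltnW.
exists x => k; exists (size (w k)), (size (w k.+1)).
by rewrite -!wx; split=> //; have [] := wS k.
Qed.

(** Koenig's lemma: a node with infinitely many elements of [A] above it has a child with the same
    property. *)
Lemma infinite_branch (A : set (seq bool)) : infinite_set A ->
  exists p : nat -> bool,
    forall n, infinite_set (A `&` [set s | prefix (mkseq p n) s]).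
Proof.
move=> infA; pose P s := infinite_set (A `&` [set t | prefix s t]).
have [|k s Ps|p pP] := @prefix_chain_limit P (fun _ _ _ => True).
- by apply: sub_infinite_set infA => s As; split=> //; exact: prefix0s.
- have [b Pb] : exists b, P (rcons s b).
    apply: contrapT => /forallNP fin; apply: Ps.
    apply: (@sub_finite_set _ _ ([set s] `|`
      ((A `&` [set t | prefix (rcons s true) t]) `|`
       (A `&` [set t | prefix (rcons s false) t])))).
      move=> t [At /prefixP[[|b r] tE]]; first by left; rewrite tE cats0.
      right; move: At; rewrite tE -cat_rcons.
      by case: b {tE} => At; [left|right]; split=> //; apply: prefix_prefix.
    rewrite !finite_setU; split; first exact: finite_set1.
    by split; apply: contrapT => infb; [apply: (fin true)|apply: (fin false)].
  by exists (rcons s b); rewrite prefix_rcons size_rcons.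
- exists p => n; have [m [_ [nm Pm _]]] := pP n.
  apply: sub_infinite_set Pm => t [At mt]; split=> //.
  exact: prefix_trans (mkseq_prefix _ nm) mt.
Qed.

(* [p] is a limit point of [A] and [x] is a concatenation of elements of [A]
   chosen so that each of them agrees with [p] up to the length of the part of
   [x] that precedes it. *)
Lemma limit_and_concatenation (A : set (seq bool)) : infinite_set A ->
  exists p x : nat -> bool, infinite_set (A `&`
    [set a | exists n, [/\ n < size a, prefix (mkseq p n) a
                         & prefix (mkseq x n ++ a) (mkseq x (n + size a))]]).
Proof.
move=> infA; have [p pP] := infinite_branch infA; exists p.
(* Each piece [a] is longer than all that precedes it, so the pieces have unbounded length and are
   infinitely many. *)
pose R s t := exists a, [/\ A a, t = s ++ a, prefix (mkseq p (size s)) a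
                           & size s < size a].
have [//|_ s _|x xP] := @prefix_chain_limit setT (fun _ => R).
  have /infinite_seq_boolP/(_ (size s))[a [Aa pa] sa] := pP (size s).
  exists (s ++ a); split=> //; last by exists a.
    exact: prefix_prefix.
  by rewrite size_cat -addn1 leq_add2l (leq_ltn_trans _ sa).
exists x; apply/infinite_seq_boolP => N.
have [n [m [Nn _ [a [Aa xma]]]]] := xP N; rewrite size_mkseq => pa na.
exists a; last exact: leq_ltn_trans na.
split=> //; exists n; split=> //; rewrite -xma.
have := congr1 size xma; rewrite size_cat !size_mkseq => <-.
exact: prefix_refl.
Qed.

(** * Meager sets in Cantor space *)

Lemma nbhs_cantorP (x : cantor_space) (U : set cantor_space) :
  nbhs x U <-> exists n, [set y : cantor_space | mkseq y n = mkseq x n] `<=` U.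
Proof.
pose cyl n := [set y : cantor_space | mkseq y n = mkseq x n].
have cylS m n : m <= n -> cyl n `<=` cyl m.
  move=> mn y; rewrite /cyl /= => yx.
  have := @mkseq_prefix _ y _ _ mn; rewrite yx => /prefix_mkseq.
  by rewrite size_mkseq.
split=> [xU|[n nU]].
  pose F := filter_from [set: nat] cyl.
  have FF : Filter F.
    apply: filter_fromT_filter; first by exists 0.
    move=> i j; exists (maxn i j) => y yij.
    by split; apply: cylS yij; rewrite ?leq_maxl ?leq_maxr.
  (* The product topology is a supremum over the coordinates, so convergence of the cylinder filter
     is checked one coordinate at a time. *)
  have Fx : F --> x.
    apply/cvg_sup => i; apply/cvg_image.
      by apply/seteqP; split=> // b _; exists (fun=> b).
    move=> V /nbhs_singleton Vx; exists [set y : cantor_space | V (y i)].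
      exists i.+1 => // y yx; rewrite /= -(nth_mkseq false y (ltnSn i)).
      by rewrite yx nth_mkseq.
    by apply/seteqP; split=> [_ [y Vy <-]//|b Vb]; exists (fun=> b).
  have [n _ nU] := Fx _ xU; by exists n.
(* Conversely, a cylinder is a finite intersection of preimages of points of the discrete space
   [bool]. *)
apply: filterS nU _.
elim: n => [|n IH].
  by apply: filterS filterT.
have pn : nbhs x [set y : cantor_space | y n = x n].
  exact: (@proj_continuous nat (fun=> bool) n x) (discrete_set1 (x n)).
apply: filterS (filterI IH pn) => y [/= yx yxn].
rewrite /mkseq -addn1 iotaD !map_cat /= add0n yxn; congr cat; exact: yx.
Qed.

Lemma meager_of_nwd (M : set cantor_space) (T : nat -> set (seq bool)) :
  (forall n, nwd (T n)) ->
  (forall x : cantor_space, M x ->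
     exists n, infinite_set (range (mkseq x) `&` T n)) ->
  meager M.
Proof.
move=> nT MT.
(* Intersecting with [M] gives the equality that [meager] demands. *)
exists (fun n => M `&` [set x : cantor_space |
    infinite_set (range (mkseq x) `&` T n)]); last first.
  apply/seteqP; split=> [x Mx|x [n _ []]//].
  by have [n xn] := MT x Mx; exists n.
move=> n; rewrite /nowhere_dense -subset0 => x /nbhs_cantorP[k kcl].
(* The branches through [t] have only segments shorter than [t] in [T n]. *)
have [t kt tT] := nT n (mkseq x k).
pose y : cantor_space := nth false t.
have yt : mkseq y (size t) = t by rewrite mkseq_nth.
have /kcl/(_ [set z : cantor_space | mkseq z (size t) = mkseq y (size t)])[] :
    mkseq y k = mkseq x k.
  by rewrite [RHS](prefix_mkseq (_ : prefix _ (mkseq y (size t))))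
    ?size_mkseq ?yt.
  by apply/nbhs_cantorP; exists (size t).
move=> z [[_ +] /=]; rewrite yt => + zt.
move=> /infinite_seq_boolP/(_ (size t))[_ [[l _ <-] Tl]].
rewrite size_mkseq => tl; apply: (tT _ _ Tl).
by rewrite -zt; apply: mkseq_prefix; apply: ltnW.
Qed.

(** The tree of initial segments of a nowhere dense set of points is nwd, since every cylinder
    contains a smaller one that misses the set. *)
Lemma meager_nwd_trees (M : set cantor_space) : meager M ->
  exists2 T : nat -> set (seq bool), forall n, nwd (T n) &
    forall x : cantor_space, M x -> exists n, forall k, T n (mkseq x k).
Proof.
move=> [F nF ->].
exists (fun n => [set s | exists2 x : cantor_space, F n x & s = mkseq x (size s)]).
  move=> n s; pose x : cantor_space := nth false s.
  have xs : mkseq x (size s) = s by rewrite mkseq_nth.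
  have /not_implyP[_ /existsNP[y /not_implyP[yx ncl]]] :
      ~ (True -> [set y : cantor_space | mkseq y (size s) = mkseq x (size s)]
           `<=` closure (F n)).
    move=> /(_ I) scl; suff : interior (closure (F n)) x by rewrite nF.
    by apply/nbhs_cantorP; exists (size s).
  have [U /nbhs_cantorP[k kU] FU] :
      exists2 U : set cantor_space, nbhs y U & F n `&` U = set0.
    by move: ncl => /existsNP[U /not_implyP[yU /set0P/negP/negPn/eqP FU]]; exists U.
  (* Long enough to extend [s] and to lie inside the cylinder that misses [F n]. *)
  exists (mkseq y (maxn k (size s))).
    by rewrite -[X in prefix X]xs -yx mkseq_prefix// leq_maxr.
  move=> u yu [z Fz uz]; suff : (F n `&` U) z by rewrite FU.
  split=> //; apply: kU => /=.
  have /prefix_mkseq : prefix (mkseq y k) (mkseq z (size u)).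
    by rewrite -uz (prefix_trans _ yu)// mkseq_prefix// leq_maxl.
  by rewrite size_mkseq.
by move=> x [n _ Fx]; exists n => k; exists x; rewrite ?size_mkseq.
Qed.

(** Baire category by a chain that leaves [T k] for good at step [k]; the minimum non(M) thus ranges
    over a nonempty class. *)
Lemma cantor_nonmeager : ~ meager [set: cantor_space].
Proof.
move=> /meager_nwd_trees[T nT allT].
have [//|k s _|x xP] := @prefix_chain_limit setT
  (fun k s t => forall u, prefix t u -> ~ T k u).
  have [t /prefixP[r ->] tT] := nT k s.
  (* The extra letter makes the extension strict. *)
  exists ((s ++ r) ++ [:: true]); split=> //.
  - by rewrite -catA prefix_prefix.
  - by rewrite !size_cat addn1 ltnS leq_addr.
  - by move=> u /catl_prefix; apply: tT.
have [n xT] := allT x I.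
by have [i [j [_ _ /(_ _ (prefix_refl _))]]] := xP n; apply.
Qed.

(** * The two inequalities *)

Lemma infinite_range_mkseq (x : nat -> bool) : infinite_set (range (mkseq x)).
Proof.
by apply/infinite_seq_boolP => N; exists (mkseq x N.+1); rewrite ?size_mkseq.
Qed.

Lemma branches_non_star_omega_family (S : set cantor_space) : ~ meager S ->
  non_star_omega_family nwd ((fun x : cantor_space => range (mkseq x)) @` S).
Proof.
move=> nmS; split=> [_ [x _ <-]|Bs [Bsn /card_esym/pcard_eqP[f]]].
  by split=> //; apply: eq_card_nat => //; apply: infinite_range_mkseq.
apply: contrapT => noA; apply: nmS; apply: (@meager_of_nwd _ f).
  by move=> n; apply: Bsn; apply: funS.
move=> x Sx; apply: contrapT => /forallNP fin; apply: noA.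
exists (range (mkseq x)); first by exists x.
move=> B BsB; have [n _ <-] := @surj _ _ _ _ f B BsB.
exact: contrapT (fin n).
Qed.

Lemma nonmeager_of_non_star_omega_family (F : set (set (seq bool))) :
  non_star_omega_family nwd F -> exists2 S : set cantor_space, ~ meager S & S #<= F.
Proof.
move=> [Finf Fad].
have /choice[px pxP] : forall A : set (seq bool),
    exists px : cantor_space * cantor_space, F A -> infinite_set (A `&`
      [set a | exists n, [/\ n < size a, prefix (mkseq px.1 n) a
        & prefix (mkseq px.2 n ++ a) (mkseq px.2 (n + size a))]]).
  move=> A; have [FA|nFA] := pselect (F A); last by exists (point, point).
  have /limit_and_concatenation[p [x px]] : infinite_set A.
    by apply/infiniteP; have [_ /card_eqPle[]] := Finf A FA.
  by exists (p, x).
(* If the limit points form a nonmeager set, they serve; otherwise the concatenations must. *)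
have [mP|] := pselect (meager ((fun A => (px A).1) @` F)); last first.
  by exists ((fun A => (px A).1) @` F) => //; apply: card_image_le.
exists ((fun A => (px A).2) @` F); last exact: card_image_le.
move=> mX; have [T nT PT] := meager_nwd_trees mP.
have [U nU XU] := meager_nwd_trees mX.
(* The trees that capture the limit point and the concatenation may carry different indices, hence
   the pairs. *)
pose C (mn : nat * nat) := [set s | exists w,
  [/\ size w <= size s, T mn.1 (take (size w) s) & U mn.2 (w ++ s)]].
(* The singletons only serve to make the family infinite. *)
have [|A FA Afin] := Fad (range (fun i : nat * nat + seq bool =>
    match i with inl mn => C mn | inr s => [set s] end)).
  split=> [_ [[mn|s] _ <-]|].
  - exact: nwd_compare.
  - exact: finite_set_nwd (finite_set1 s).
  - apply: eq_card_nat.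
      exact: sub_countable (card_image_le _ _) (countableP _).
    apply: (@sub_infinite_set _ (range (@set1 (seq bool)))).
      by move=> _ [s _ <-]; exists (inr s).
    apply/infiniteP.
    have /card_esym/card_eqPle[+ _] : range (@set1 (seq bool)) #= [set: seq bool].
      by apply: inj_card_eq => s t _ _ /seteqP[/(_ s erefl)].
    apply: card_le_trans; apply/infiniteP; apply/infinite_seq_boolP => N.
    by exists (nseq N.+1 true); rewrite ?size_nseq.
have [m pT] := PT (px A).1 (ex_intro2 _ _ A FA erefl).
have [n xU] := XU (px A).2 (ex_intro2 _ _ A FA erefl).
apply: (pxP A FA); apply: sub_finite_set (Afin (C (m, n)) _); last first.
  by exists (inl (m, n)).
(* The part of the concatenation that precedes [a] witnesses that [a] is in [C (m, n)]. *)
move=> a [Aa [k [ka pa xa]]]; split=> //; exists (mkseq (px A).2 k).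
rewrite size_mkseq; split; first exact: ltnW.
  by move: pa; rewrite prefixE size_mkseq => /eqP ->; apply: pT.
by rewrite (prefix_mkseq xa); apply: xU.
Qed.

Theorem proposition3p28 :
  exists (F : set (set (seq bool))) (S : set cantor_space),
    [/\ least_card (non_star_omega_family nwd) F,
        least_card [set M : set cantor_space | ~ meager M] S
      & F #= S].
Proof.
have [[S nmS] /= Smin] :=
  @exists_least_card {S : set cantor_space | ~ meager S} _ (@proj1_sig _ _)
    (exist _ [set: cantor_space] cantor_nonmeager).
have {}Smin (M : set cantor_space) : ~ meager M -> S #<= M.
  by move=> nmM; exact: (Smin (exist (fun S => ~ meager S) M nmM)).
pose F := (fun x : cantor_space => range (mkseq x)) @` S.
have FS : F #<= S by exact: card_image_le.
have FF : non_star_omega_family nwd F by exact: branches_non_star_omega_family.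
(* For arbitrary [G] this yields the minimality of [F]; for [G = F], the missing half of
   equipotence. *)
have SF (G : set (set (seq bool))) : non_star_omega_family nwd G -> S #<= G.
  move=> /nonmeager_of_non_star_omega_family[M /Smin SM MG].
  exact: card_le_trans SM MG.
exists F, S; split.
- by split=> // G /SF; apply: card_le_trans.
- by split.
- by apply/card_eqPle; split; last exact: SF.
Qed.
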